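(* Let the diagonal system of hydrodynamic type $u^i_t=v^i(u)u^i_x$, $i=1,\dots,n$, be semi-Hamiltonian, and suppose that $W_\alpha=(W^1_\alpha,\dots,W^n_\alpha)$ are (the characteristic velocities of) a set of symmetries $u^i_{t_\alpha}=W^i_\alpha(u)u^i_x$ of the system which satisfy $$\sum_\alpha\epsilon_\alpha W^i_\alpha W^j_\alpha=0,\qquad i\ne j,$$ for certain $\epsilon_\alpha=\pm1$. Then the functions $$Q^{\,i}:=\sum_\alpha\epsilon_\alpha\,(W^i_\alpha)^2,\qquad i=1,\dots,n,$$ satisfy the system $$\partial_j\ln\sqrt{Q^{\,i}}=-\frac{\partial_j v^i}{v^j-v^i},\qquad i\ne j.$$
   Context: $\partial_j=\partial/\partial u^j$. A diagonal system $u^i_t=v^i(u)u^i_x$ (with pairwise distinct characteristic velocities $v^i$) is semi-Hamiltonian if $\partial_j\left(\frac{\partial_k v^i}{v^i-v^k}\right)=\partial_k\left(\frac{\partial_j v^i}{v^i-v^j}\right)$ for all pairwise distinct $i,j,k$. Its symmetries are the diagonal flows $u^i_\tau=w^i(u)u^i_x$ whose characteristic velocities satisfy $\partial_j w^i=\frac{\partial_j v^i}{v^j-v^i}(w^j-w^i)$ for $i\ne j$. The expression $\partial_j\ln\sqrt{Q^i}$ is understood as $\partial_jQ^i/(2Q^i)$ where $Q^i\neq 0$. *)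

(* Defs.v *)
From HB Require Import structures.
From mathcomp Require Import all_boot all_order all_algebra.
From mathcomp Require Import all_classical all_reals all_analysis.

Set Implicit Arguments.
Unset Strict Implicit.
Unset Printing Implicit Defensive.

Import Order.TTheory GRing.Theory Num.Theory.
Import numFieldNormedType.Exports.

Local Open Scope classical_set_scope.
Local Open Scope ring_scope.

(* Points u = (u^1, ..., u^n) are row vectors; velocities are indexed families
   v : 'I_n -> 'rV[R]_n -> R, with v i u standing for v^i(u). *)

Definition ebase (R : realType) (n : nat) (j : 'I_n) : 'rV[R]_n :=
  delta_mx ord0 j.

Definition pd (R : realType) (n : nat) (j : 'I_n) (f : 'rV[R]_n -> R)
    (u : 'rV[R]_n) : R :=
  'D_(ebase R j) f u.

(* f is of class C^k on the open set U.  The derivability clause is needed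
   because 'D is total. *)
Fixpoint classC (R : realType) (n : nat) (k : nat) (U : set 'rV[R]_n)
    (f : 'rV[R]_n -> R) : Prop :=
  (forall u, U u -> {for u, continuous f}) /\
  (if k is k'.+1 then
     forall j : 'I_n,
       (forall u, U u -> derivable f u (ebase R j)) /\ classC k' U (pd j f)
   else True).

Definition distinct_velocities (R : realType) (n : nat) (U : set 'rV[R]_n)
    (v : 'I_n -> 'rV[R]_n -> R) : Prop :=
  forall i j : 'I_n, i != j -> forall u, U u -> v i u != v j u.

Definition semi_hamiltonian (R : realType) (n : nat) (U : set 'rV[R]_n)
    (v : 'I_n -> 'rV[R]_n -> R) : Prop :=
  forall i j k : 'I_n, i != j -> i != k -> j != k ->
  forall u, U u ->
    pd j (fun x => pd k (v i) x / (v i x - v k x)) u =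
    pd k (fun x => pd j (v i) x / (v i x - v j x)) u.

(* w is the family of characteristic velocities of a symmetry
   u^i_tau = w^i(u) u^i_x of the system u^i_t = v^i(u) u^i_x. *)
Definition is_symmetry (R : realType) (n : nat) (U : set 'rV[R]_n)
    (v w : 'I_n -> 'rV[R]_n -> R) : Prop :=
  (forall i : 'I_n, classC 1 U (w i)) /\
  (forall i j : 'I_n, i != j -> forall u, U u ->
     pd j (w i) u = pd j (v i) u / (v j u - v i u) * (w j u - w i u)).

Definition Qsum (R : realType) (n : nat) (A : finType) (eps : A -> R)
    (W : A -> 'I_n -> 'rV[R]_n -> R) (i : 'I_n) (u : 'rV[R]_n) : R :=
  \sum_(a : A) eps a * (W a i u) ^+ 2.

(* The logarithmic derivative d_j ln sqrt f, read as d_j f / (2 f); meaningful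
   only where f is nonzero (f may be negative there). *)
Definition pd_ln_sqrt (R : realType) (n : nat) (j : 'I_n)
    (f : 'rV[R]_n -> R) (u : 'rV[R]_n) : R :=
  pd j f u / (2 * f u).

(* Main.v *)
Require Import Defs.
From HB Require Import structures.
From mathcomp Require Import all_boot all_order all_algebra.
From mathcomp Require Import all_classical all_reals all_analysis.
From mathcomp Require Import ring.

Import Order.TTheory GRing.Theory Num.Theory.
Import numFieldNormedType.Exports.

Local Open Scope classical_set_scope.
Local Open Scope ring_scope.

(** By the product rule ([is_derive_Qsum]), half of d_j Q^i is the sum of eps_a W_a^i d_j W_a^i. The
    symmetry equation gives d_j W_a^i = c (W_a^j - W_a^i), where c = d_j v^i / (v^j - v^i) is the
    same for every a. The cross terms then vanish by orthogonality, leaving d_j Q^i = -2 c Q^i. *)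

Lemma is_derive_Qsum (R : realType) (n : nat) (A : finType) (eps : A -> R)
    (W : A -> 'I_n -> 'rV[R]_n -> R) (i j : 'I_n) (u : 'rV[R]_n) :
  (forall a, derivable (W a i) u (ebase R j)) ->
  is_derive u (ebase R j) (Qsum eps W i)
    (2 * \sum_a eps a * W a i u * pd j (W a i) u).
Proof.
move=> dW; have dWP a := derivableP (dW a).
have -> : Qsum eps W i = \sum_a (eps a *: (W a i ^+ 2)).
  by apply/funext => x; rewrite /Qsum fct_sumE.
rewrite mulr_sumr.
(* Being a function paired with its derivative is stable under sums, so one summand suffices. *)
apply: (big_ind2 (fun f df => is_derive u (ebase R j) f df)) => [|f df g dg fP gP|a _].
- exact: is_derive_cst.
- exact: is_deriveD.
- apply: is_derive_eq.
  by rewrite /pd /GRing.scale /= /GRing.scale /=; ring.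
Qed.

Theorem proposition3 (R : realType) (n : nat) (U : set 'rV[R]_n)
    (v : 'I_n -> 'rV[R]_n -> R)
    (A : finType) (W : A -> 'I_n -> 'rV[R]_n -> R) (eps : A -> R)
    (U_open : open U)
    (v_C2 : forall i : 'I_n, classC 2 U (v i))
    (v_distinct : distinct_velocities U v)
    (v_semiH : semi_hamiltonian U v)
    (W_sym : forall a : A, is_symmetry U v (W a))
    (eps_pm1 : forall a : A, eps a = 1 \/ eps a = -1)
    (W_orth : forall i j : 'I_n, i != j -> forall u, U u ->
       \sum_(a : A) eps a * W a i u * W a j u = 0) :
  forall i j : 'I_n, i != j -> forall u, U u -> Qsum eps W i u != 0 ->
    derivable (Qsum eps W i) u (ebase R j) /\
    pd_ln_sqrt j (Qsum eps W i) u = - (pd j (v i) u / (v j u - v i u)).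
Proof.
move=> i j ij u Uu Q0.
have dW a : derivable (W a i) u (ebase R j).
  have [CW _] := W_sym a.
  by have [_ /(_ j) [dWi _]] := CW i; exact: dWi.
have [dQ DQ] := is_derive_Qsum _ _ _ eps _ _ _ _ dW.
split=> //; rewrite /pd_ln_sqrt /pd DQ -/(pd j (v i) u).
set c := pd j (v i) u / _.
(* Since [c] does not depend on [a], it leaves the sum; [W_orth] kills the mixed part, and the
   square part is Q^i. *)
have -> : \sum_a eps a * W a i u * pd j (W a i) u = - c * Qsum eps W i u.
  under eq_bigr => a _.
    rewrite (W_sym a).2 // -/c mulrCA mulrBr mulrBr.
    over.
  rewrite sumrB -!mulr_sumr W_orth // mulr0 sub0r mulNr.
  by congr (- (c * _)); apply: eq_bigr => a _; rewrite expr2 mulrA.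
(* With [c] kept as an atom, the denominator is twice Q^i, nonzero by [Q0]. *)
by field.
Qed.
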